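(* Let $M$ be a Riemannian manifold, let $R$ be a retraction on $M$, and let $f:M\to\mathbb{R}$ be a smooth function. Let $0<c_1<c_2<1/2$. Let $\{x_k\}_{k=0,1,\dots}\subset M$, with search directions $\eta_k\in T_{x_k}M$, step sizes $\alpha_k>0$ and parameters $\beta_{k+1}\in\mathbb{R}$, be any sequence generated by the Riemannian conjugate gradient iteration described in the context. Write $g_k:=\operatorname{grad} f(x_k)$. Suppose that each $\alpha_k>0$ satisfies the strong Wolfe conditions $$f(R_{x_k}(\alpha_k\eta_k))\le f(x_k)+c_1\alpha_k\langle g_k,\eta_k\rangle_{x_k},$$ $$\left|\left\langle \operatorname{grad} f(R_{x_k}(\alpha_k\eta_k)),\,\mathrm{D}R_{x_k}(\alpha_k\eta_k)[\eta_k]\right\rangle_{R_{x_k}(\alpha_k\eta_k)}\right|\le c_2\left|\langle g_k,\eta_k\rangle_{x_k}\right|,$$ and that each $\beta_{k+1}$ satisfies $$|\beta_{k+1}|\le \beta^{\mathrm{FR}}_{k+1}:=\frac{\|g_{k+1}\|_{x_{k+1}}^2}{\|g_k\|_{x_k}^2}.$$ Then, for all $k=0,1,\dots$ (for which the iterate is defined), $$-\frac{1}{1-c_2}\|g_k\|_{x_k}^2\le\langle g_k,\eta_k\rangle_{x_k}\le-\frac{1-2c_2}{1-c_2}\|g_k\|_{x_k}^2.$$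
   Context: For a Riemannian manifold $M$, $\langle\cdot,\cdot\rangle_x$ denotes the Riemannian metric on $T_xM$, $\|\cdot\|_x$ the induced norm, and $\operatorname{grad} f(x)\in T_xM$ the Riemannian gradient of $f$ at $x$. $\mathrm{D}F(x)$ denotes the differential of a smooth map $F$ at $x$. A retraction on $M$ is a smooth map $R:TM\to M$ such that, with $R_x:=R|_{T_xM}$, one has for every $x\in M$: $R_x(0_x)=x$, where $0_x$ is the zero element of $T_xM$; and, under the canonical identification $T_{0_x}T_xM\simeq T_xM$, $\mathrm{D}R_x(0_x)[\xi]=\xi$ for all $\xi\in T_xM$. For $x\in M$ and $\eta,\xi\in T_xM$, the differentiated retraction is $\mathcal{T}^R_\eta(\xi):=\mathrm{D}R_x(\eta)[\xi]\in T_{R_x(\eta)}M$ (identifying $T_\eta T_xM\simeq T_xM$). The scaled vector transport with respect to $R$ is $$\mathcal{T}^S_\eta(\xi):=\begin{cases}\mathcal{T}^R_\eta(\xi), & \text{if } \|\mathcal{T}^R_\eta(\xi)\|_{R_x(\eta)}\le\|\xi\|_x,\\[4pt] \dfrac{\|\xi\|_x}{\|\mathcal{T}^R_\eta(\xi)\|_{R_x(\eta)}}\,\mathcal{T}^R_\eta(\xi), & \text{otherwise.}\end{cases}$$ Riemannian conjugate gradient iteration: given an initial point $x_0\in M$, set $g_0:=\operatorname{grad} f(x_0)$ and $\eta_0:=-g_0$. For $k=0,1,\dots$, choose a step size $\alpha_k>0$, set $x_{k+1}:=R_{x_k}(\alpha_k\eta_k)$ and $g_{k+1}:=\operatorname{grad}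 f(x_{k+1})$, choose a parameter $\beta_{k+1}\in\mathbb{R}$, and set $$\eta_{k+1}:=-g_{k+1}+\beta_{k+1}\mathcal{T}^S_{\alpha_k\eta_k}(\eta_k).$$ The iteration is stopped at index $k$ if $g_k=0$, so that $\beta^{\mathrm{FR}}_{k+1}$ is always well defined. *)

(* Defs.v *)
From HB Require Import structures.
From mathcomp Require Import all_boot all_order all_algebra.
From mathcomp Require Import all_classical all_reals all_analysis.

Set Implicit Arguments.
Unset Strict Implicit.
Unset Printing Implicit Defensive.

Import Order.TTheory GRing.Theory Num.Theory.
Import numFieldNormedType.Exports.

Local Open Scope classical_set_scope.
Local Open Scope ring_scope.

(* Meant for A open and V finite-dimensional, where a map is C^{k+1} iff it is
   differentiable and all its directional derivatives are C^k. *)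
Fixpoint Ck (R : realType) (V W : normedModType R) (A : set V) (k : nat)
    (f : V -> W) : Prop :=
  match k with
  | 0 => forall x, A x -> {for x, continuous f}
  | k'.+1 => (forall x, A x -> differentiable f x) /\
             (forall v : V, Ck A k' (fun x => 'D_v f x))
  end.

Definition smooth_on (R : realType) (V W : normedModType R) (A : set V)
    (f : V -> W) : Prop := open A /\ forall k, Ck A k f.

(* A homeomorphism from an open subset of M onto an open subset of R^n. Both
   maps are total; their values off cdom, resp. off its image, are irrelevant. *)
Record chart (R : realType) (n : nat) (M : topologicalType) := Chart {
  cdom : set M;
  cmap : M -> 'rV[R]_n;
  cinv : 'rV[R]_n -> M;
  cdom_open : open cdom;
  cimg_open : open (cmap @` cdom);
  cmapK : forall x, cdom x -> cinv (cmap x) = x;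
  cmap_cont : forall x, cdom x -> {for x, continuous cmap};
  cinv_cont : forall u, (cmap @` cdom) u -> {for u, continuous cinv} }.

Definition cimg (R : realType) (n : nat) (M : topologicalType)
  (c : chart R n M) : set 'rV[R]_n := cmap c @` cdom c.

(* chart_at picks, for each point, one chart of the atlas around it. It is used
   only to write tangent vectors in coordinates; no regularity in x is needed. *)
Record smoothManifold (R : realType) (n : nat) := SmoothManifold {
  mcarrier :> topologicalType;
  mhausdorff : hausdorff_space mcarrier;
  msecond_countable : @second_countable mcarrier;
  atlas : set (chart R n mcarrier);
  chart_at : mcarrier -> chart R n mcarrier;
  chart_at_atlas : forall x, atlas (chart_at x);
  chart_at_dom : forall x, cdom (chart_at x) x;
  atlas_compat : forall c d, atlas c -> atlas d ->
    smooth_on (cmap c @` (cdom c `&` cdom d)) (cmap d \o cinv c) }.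

(* A tangent vector at x is given by its components in the chart chart_at x.
   The components in another chart c around x are obtained by applying the
   differential of the transition map; see tvec for the converse passage. The
   normed structure inherited from R^n only serves to differentiate maps defined
   on the tangent space: it is unrelated to the Riemannian norm. *)
Definition tangent (R : realType) (n : nat) (M : smoothManifold R n) (x : M)
  : Type := 'rV[R]_n.

HB.instance Definition _ (R : realType) (n : nat) (M : smoothManifold R n)
  (x : M) := NormedModule.copy (tangent x) 'rV[R]_n.

(* The tangent vector at cinv c u whose components in the chart c are w. For c
   in the atlas, (u, w) |-> (cinv c u, tvec c u w) is the inverse of the chart of
   the tangent bundle induced by c, defined on cimg c * R^n. *)
Definition tvec (R : realType) (n : nat) (M : smoothManifold R n)
    (c : chart R n M) (u w : 'rV[R]_n) : tangent (cinv c u) :=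
  'd (cmap (chart_at (cinv c u)) \o cinv c) u w.

Record riemannianManifold (R : realType) (n : nat) := RiemannianManifold {
  rcarrier :> smoothManifold R n;
  inner : forall x : rcarrier, tangent x -> tangent x -> R;
  innerC : forall x (u v : tangent x), inner u v = inner v u;
  inner_linear : forall x (a : R) (u v w : tangent x),
    inner (a *: u + v) w = a * inner u w + inner v w;
  inner_gt0 : forall x (u : tangent x), u != 0 -> 0 < inner u u;
  inner_smooth : forall (c : chart R n rcarrier) (i j : 'I_n), atlas c ->
    smooth_on (cimg c)
      (fun u => inner (tvec c u (delta_mx 0 i)) (tvec c u (delta_mx 0 j))
         : R^o) }.

Definition rnorm (R : realType) (n : nat) (M : riemannianManifold R n) (x : M)
  (v : tangent x) : R := Num.sqrt (inner v v).

Definition smooth_fun (R : realType) (n : nat) (M : smoothManifold R n)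
    (f : M -> R) : Prop :=
  forall c, atlas c -> smooth_on (cimg c) (f \o cinv c : 'rV[R]_n -> R^o).

Definition dfun (R : realType) (n : nat) (M : smoothManifold R n) (f : M -> R)
    (x : M) (v : tangent x) : R :=
  'd (f \o cinv (chart_at x) : 'rV[R]_n -> R^o) (cmap (chart_at x) x) v.

(* The unique g in T_x M with <g, v>_x = D f(x)[v] for all v; see gradP and
   grad_unique below. *)
Definition grad (R : realType) (n : nat) (M : riemannianManifold R n)
    (f : M -> R) (x : M) : tangent x :=
  xget 0 [set g : tangent x | forall v : tangent x, inner g v = dfun f v].

Definition dretr (R : realType) (n : nat) (M : smoothManifold R n)
    (r : forall x : M, tangent x -> M) (x : M) (eta xi : tangent x)
    : tangent (r x eta) :=
  'd (cmap (chart_at (r x eta)) \o r x : tangent x -> 'rV[R]_n) eta xi.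

(* Smoothness of the map TM -> M is read in the charts of TM induced by the atlas
   of M; that the sets below are open amounts to its continuity. The equation
   retr_d0 compares vectors of T_{R_x(0)} M and of T_x M, which are the same
   space by retr0. *)
Record retraction (R : realType) (n : nat) (M : smoothManifold R n) :=
  Retraction {
  retr :> forall x : M, tangent x -> M;
  retr_smooth : forall c d : chart R n M, atlas c -> atlas d ->
    let rc := fun p : 'rV[R]_n * 'rV[R]_n => retr (tvec c p.1 p.2) in
    smooth_on [set p | cimg c p.1 /\ cdom d (rc p)] (cmap d \o rc);
  retr0 : forall x, retr (0 : tangent x) = x;
  retr_d0 : forall (x : M) (xi : tangent x), dretr retr 0 xi = xi }.

Definition scaled_transport (R : realType) (n : nat)
    (M : riemannianManifold R n) (rt : retraction M) (x : M)
    (eta xi : tangent x) : tangent (rt x eta) :=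
  let t := dretr rt eta xi in
  if rnorm t <= rnorm xi then t else (rnorm xi / rnorm t) *: t.

(* The sequences are indexed by all of nat, but no condition is imposed on what
   follows the first index at which the gradient vanishes. The iterate of index k
   is defined as soon as no earlier gradient is zero. *)
Definition iterate_defined (R : realType) (n : nat)
    (M : riemannianManifold R n) (f : M -> R) (x : nat -> M) (k : nat) : Prop :=
  forall j, (j < k)%N -> grad f (x j) != 0.

(* The last equation takes place in T_{x_{k+1}} M, which is T_{R_{x_k}(alpha_k
   eta_k)} M by the equation before it. *)
Definition rcg_sequence (R : realType) (n : nat) (M : riemannianManifold R n)
    (rt : retraction M) (f : M -> R) (x : nat -> M)
    (eta : forall k, tangent (x k)) (alpha beta : nat -> R) : Prop :=
  eta 0%N = - grad f (x 0%N) /\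
  forall k, iterate_defined f x k.+1 ->
    [/\ 0 < alpha k,
        x k.+1 = rt (x k) (alpha k *: eta k) &
        eta k.+1 = - grad f (x k.+1) +
          beta k.+1 *: (scaled_transport rt (alpha k *: eta k) (eta k)
                         : tangent (x k.+1))].

Definition strong_wolfe (R : realType) (n : nat) (M : riemannianManifold R n)
    (rt : retraction M) (f : M -> R) (c1 c2 : R) (x : M) (eta : tangent x)
    (alpha : R) : Prop :=
  f (rt x (alpha *: eta)) <= f x + c1 * alpha * inner (grad f x) eta /\
  `| inner (grad f (rt x (alpha *: eta))) (dretr rt (alpha *: eta) eta) |
    <= c2 * `| inner (grad f x) eta |.

Definition beta_FR (R : realType) (n : nat) (M : riemannianManifold R n)
    (f : M -> R) (x : nat -> M) (k : nat) : R :=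
  rnorm (grad f (x k.+1)) ^+ 2 / rnorm (grad f (x k)) ^+ 2.

Section Gradient.
Context (R : realType) (n : nat) (M : riemannianManifold R n).
Implicit Types (x : M) (f : M -> R).

Let inner0 x (w : tangent x) : inner 0 w = 0.
Proof.
have := inner_linear 1 0 0 w; rewrite scaler0 addr0 mul1r.
by move/eqP; rewrite -subr_eq0 opprD addrA subrr sub0r oppr_eq0 => /eqP.
Qed.

Let inner_sum x (I : finType) (a : I -> R) (e : I -> tangent x) (w : tangent x) :
  inner (\sum_i a i *: e i) w = \sum_i a i * inner (e i) w.
Proof.
by elim/big_rec2: _ => [|i y1 y2 _ <-]; [exact: inner0|rewrite inner_linear].
Qed.

Let inner_mx x (u v : 'rV[R]_n) :
  @inner R n M x u v =
  (u *m (\matrix_(i, j) @inner R n M x (delta_mx 0 i) (delta_mx 0 j))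
     *m v^T) 0 0.
Proof.
rewrite {1}(row_sum_delta u) (inner_sum _ (fun i => delta_mx 0 i : tangent x)).
rewrite -mulmxA mxE; apply: eq_bigr => i _; congr (_ * _).
rewrite innerC {1}(row_sum_delta v).
rewrite (inner_sum _ (fun i => delta_mx 0 i : tangent x)) mxE.
by apply: eq_bigr => j _; rewrite !mxE mulrC innerC.
Qed.

Lemma gradP f x (v : tangent x) : inner (grad f x) v = dfun f v.
Proof.
rewrite /grad; case: xgetP => [g _ ->//|noP]; exfalso.
set G := (\matrix_(i, j) @inner R n M x (delta_mx 0 i) (delta_mx 0 j)).
have Gu : G \in unitmx.
  rewrite -row_free_unit -kermx_eq0; apply/eqP/row_matrixP => i.
  rewrite row0; apply/eqP/negPn/negP => ui.
  have := @inner_gt0 R n M x _ ui; rewrite inner_mx -/G.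
  by rewrite -row_mul mulmx_ker row0 mul0mx mxE ltxx.
pose d : 'rV[R]_n := \row_i @dfun R n M f x (delta_mx 0 i).
apply: (noP (d *m invmx G)) => w /=; rewrite inner_mx -/G.
rewrite mulmxKV// [in RHS](row_sum_delta w) /dfun linear_sum mxE.
by apply: eq_bigr => j _; rewrite linearZ !mxE mulrC.
Qed.

Lemma grad_unique f x (g : tangent x) :
  (forall v : tangent x, inner g v = dfun f v) -> g = grad f x.
Proof.
move=> gP; apply/eqP; rewrite -subr_eq0; apply/negPn/negP => /inner_gt0.
rewrite -[X in inner X](_ : (-1) *: grad f x + g = _); last first.
  by rewrite scaleN1r addrC.
by rewrite inner_linear gradP gP mulN1r addNr ltxx.
Qed.

End Gradient.

(* Main.v *)
Require Import Defs.
From mathcomp Require Import all_boot all_order all_algebra.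
From mathcomp Require Import all_classical all_reals all_analysis.
From mathcomp Require Import ring lra.
Import Order.TTheory GRing.Theory Num.Theory.
Local Open Scope ring_scope.

(** By induction on [k]. The scaling factor of the scaled transport lies in
    [[0, 1]], so the curvature condition and the induction hypothesis give
    [|<g_{k+1}, T^S(eta_k)>| <= c2 |<g_k, eta_k>| <= c2 / (1 - c2) ||g_k||^2];
    multiplying by [|beta_{k+1}| <= ||g_{k+1}||^2 / ||g_k||^2] shows that
    [<g_{k+1}, eta_{k+1}>] differs from [- ||g_{k+1}||^2] by at most
    [c2 / (1 - c2) ||g_{k+1}||^2], which is the claim. *)

Section InnerProduct.
Context {R : realType} {n : nat} {M : riemannianManifold R n}.

Lemma inner0l (x : M) (w : tangent x) : inner 0 w = 0.
Proof. by have := inner_linear 1 0 0 w; rewrite scaler0 addr0 => h; lra. Qed.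

Lemma innerZr (x : M) (a : R) (u v : tangent x) :
  inner u (a *: v) = a * inner u v.
Proof. by rewrite innerC -[a *: v]addr0 inner_linear inner0l addr0 innerC. Qed.

Lemma innerDr (x : M) (u v w : tangent x) :
  inner u (v + w) = inner u v + inner u w.
Proof.
by rewrite innerC -[v]scale1r inner_linear mul1r scale1r !(innerC u).
Qed.

Lemma innerNr (x : M) (u v : tangent x) : inner u (- v) = - inner u v.
Proof. by rewrite -scaleN1r innerZr mulN1r. Qed.

Lemma inner_ge0 (x : M) (u : tangent x) : 0 <= inner u u.
Proof.
by have [->|/inner_gt0/ltW//] := eqVneq u 0; rewrite inner0l.
Qed.

Lemma sqr_rnorm (x : M) (u : tangent x) : rnorm u ^+ 2 = inner u u.
Proof. by rewrite sqr_sqrtr// inner_ge0. Qed.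

(** Transfers the curvature condition, stated with [dretr], to the transported direction. *)
Lemma normr_inner_scaled_transport (rt : retraction M) (x : M)
    (eta xi : tangent x) (u : tangent (rt x eta)) :
  `|inner u (scaled_transport rt eta xi)| <= `|inner u (dretr rt eta xi)|.
Proof.
rewrite /scaled_transport; case: (leP (rnorm _)) => // lt_xi_t.
have xi_ge0 : 0 <= rnorm xi by exact: sqrtr_ge0.
have t_gt0 := le_lt_trans xi_ge0 lt_xi_t.
rewrite innerZr normrM ler_piMl// ger0_norm; last by rewrite divr_ge0// ltW.
by rewrite ler_pdivrMr// mul1r ltW.
Qed.

(* [eq_yz] does not make [tangent y] and [tangent z] the same instance of the
   metric; both are however convertible to ['rV_n], whence the casts. *)
Lemma inner_grad_cast (f : M -> R) (y z : M) (t : tangent z) :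
  y = z -> inner (grad f y) (t : tangent y) = inner (grad f z) t.
Proof. by move=> eq_yz; case: z / eq_yz t. Qed.

End InnerProduct.

(* Here [G], [G'] stand for the squared gradient norms at two consecutive
   iterates, [m] for [<g_k, eta_k>] and [s] for [<g_{k+1}, T^S(eta_k)>]. *)
Lemma fletcher_reeves_step {R : realFieldType} (c G G' m s b : R) :
  0 <= c -> c < 1 / 2 -> 0 < G ->
  - (1 / (1 - c)) * G <= m -> m <= - ((1 - 2 * c) / (1 - c)) * G ->
  `|s| <= c * `|m| -> `|b| <= G' / G ->
  - (1 / (1 - c)) * G' <= - G' + b * s /\
  - G' + b * s <= - ((1 - 2 * c) / (1 - c)) * G'.
Proof.
move=> c_ge0 c_lt12 G_gt0.
(* In terms of [q], the bounds on [m] read [|m + G| <= q * G] and the conclusion reads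
   [|b * s| <= q * G']. *)
pose q := c / (1 - c).
have -> : 1 / (1 - c) = 1 + q by rewrite /q; field; lra.
have -> : (1 - 2 * c) / (1 - c) = 1 - q by rewrite /q; field; lra.
have q_ge0 : 0 <= q by apply: divr_ge0; lra.
(* This fixed-point equation makes the constant reproduce itself: [|m| <= (1 + q) * G] yields
   [|s| <= q * G]. *)
have qE : q = c * (1 + q) by rewrite /q; field; lra.
clearbody q => m_ge m_le s_le; rewrite ler_pdivlMr// => b_le.
have {}s_le : `|s| <= q * G.
  apply: le_trans s_le _; rewrite qE -mulrA ler_wpM2l// ler_norml.
  by apply/andP; split; nra.
have : `|b * s| <= q * G'.
  rewrite normrM; apply: le_trans (ler_wpM2l (normr_ge0 _) s_le) _.
  by rewrite mulrCA ler_wpM2l.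
by rewrite ler_norml => /andP[? ?]; split; lra.
Qed.

Theorem theorem3p1 (R : realType) (n : nat) (M : riemannianManifold R n)
    (rt : retraction M) (f : M -> R) (hf : smooth_fun f)
    (c1 c2 : R) (hc1 : 0 < c1) (hc12 : c1 < c2) (hc2 : c2 < 1 / 2)
    (x : nat -> M) (eta : forall k, tangent (x k)) (alpha beta : nat -> R)
    (hseq : rcg_sequence rt f eta alpha beta)
    (hwolfe : forall k, iterate_defined f x k.+1 ->
       strong_wolfe rt f c1 c2 (eta k) (alpha k))
    (hbeta : forall k, iterate_defined f x k.+1 ->
       `| beta k.+1 | <= beta_FR f x k) :
  forall k, iterate_defined f x k ->
    - (1 / (1 - c2)) * rnorm (grad f (x k)) ^+ 2 <= inner (grad f (x k)) (eta k)
    /\ inner (grad f (x k)) (eta k) <=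
       - ((1 - 2 * c2) / (1 - c2)) * rnorm (grad f (x k)) ^+ 2.
Proof.
case: hseq => eta0 etaS; elim=> [_|k IHk defSk].
  rewrite eta0 innerNr -sqr_rnorm.
  move: (_ ^+ 2) (sqr_ge0 (rnorm (grad f (x 0%N)))) => G G_ge0.
  (* What remains is [(1 - 2 * c2) / (1 - c2) <= 1 <= 1 / (1 - c2)]. *)
  by rewrite -[- G]mulN1r; split; apply: ler_wpM2r => //;
    rewrite lerN2 ?ler_pdivlMr ?ler_pdivrMr; lra.
have [IHl IHu] := IHk (fun j lt_jk => defSk j (ltnW lt_jk)).
have [_ xS ->] := etaS k defSk.
have [_ curv] := hwolfe k defSk.
rewrite innerDr innerNr innerZr -sqr_rnorm (inner_grad_cast f _ _ _ xS).
apply: fletcher_reeves_step IHl IHu _ (hbeta k defSk) => //.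
- by lra.
(* The iterate [k.+1] is defined only if the gradient at [x k] is nonzero. *)
- by rewrite sqr_rnorm inner_gt0// defSk.
- exact: le_trans (normr_inner_scaled_transport _ _ _ _ _) curv.
Qed.
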